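(* Let $\mathcal{X}=(X_1,\dots,X_n)$ be a multiset family which satisfies an inflation functional equation $\psi(\mathcal{X})=\mathcal{X}$ and is discrete and indecomposable. Then $\mathcal{X}$ is irreducible and is generated by a finite ''seed'' $\mathcal{S}^{(0)}=(S_1,\dots,S_n)$ consisting of a periodic cycle $Y=\{(\mathbf{x}_j,i_j):1\le j\le p\}$ in which $\mathbf{x}_j\in X_{i_j}$ and, for each $1\le j\le p$, there is some $\mathbf{d}_j\in\mathcal{D}_{i_{j+1},i_j}$ with $\mathbf{x}_{j+1}=A\mathbf{x}_j+\mathbf{d}_j$, where $(\mathbf{x}_{p+1},i_{p+1})=(\mathbf{x}_1,i_1)$. That is, $$\mathcal{X}=\lim_{N\to\infty}\psi^N(\mathcal{S}^{(0)}).$$ The periodic cycle $Y$ is the only periodic cycle in $\mathcal{X}$, and its elements each have multiplicity one (i.e. $m_{X_{i_j}}(\mathbf{x}_j)=1$).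
   Context: Fix integers $d,n\ge 1$, an expanding real $d\times d$ matrix $A$ (all eigenvalues, real or complex, have absolute value $>1$), and finite, possibly empty, sets $\mathcal{D}_{ij}\subset\mathbb{R}^d$ for $1\le i,j\le n$. A multiset $X$ in $\mathbb{R}^d$ is a set $\underline{X}\subset\mathbb{R}^d$ (the underlying set) with a multiplicity function $m_X:\underline{X}\to\mathbb{Z}_{>0}$, extended by $m_X(\mathbf{x})=0$ for $\mathbf{x}\notin\underline{X}$. $X\subseteq Y$ means $m_X\le m_Y$ everywhere. The multiset union $X\vee Y$ has multiplicity function $m_X+m_Y$. $A(X)$ has multiplicity $m_X(A^{-1}\mathbf{x})$ at $\mathbf{x}$, and $X+\mathcal{D}=\bigvee_{\mathbf{d}\in\mathcal{D}}(X+\mathbf{d})$. A multiset family (or $n$-multiset family) is a vector $\mathcal{X}=(X_1,\dots,X_n)$ of multisets in $\mathbb{R}^d$; union $\vee$ and inclusion $\subseteq$ are componentwise. It is nonempty if some $X_i$ is nonempty. It is discrete if, for each $i$, every bounded subset of $\mathbb{R}^d$ contains only finitely many points of $\underline{X_i}$ and all multiplicities are finite. The inflation operator is $\psi(\mathcal{X})=(X_1',\dots,X_n')$ with $X_i'=\bigvee_{j=1}^n(A(X_j)+\mathcal{D}_{ij})$, and the inflation functional equation is $\psi(\mathcal{X})=\mathcal{X}$. A nonempty multiset family $\mathcal{X}$ with $\psi(\mathcal{X})=\mathcal{X}$ is indecomposable if it cannot be written $\mathcal{X}=\mathcal{X}^{(1)}\vee\mathcal{X}^{(2)}$ with both $\mathcal{X}^{(i)}$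 nonempty and $\psi(\mathcal{X}^{(i)})=\mathcal{X}^{(i)}$. It is irreducible if there is no nonempty multiset family $\mathcal{X}'\subsetneq\mathcal{X}$ with $\psi(\mathcal{X}')=\mathcal{X}'$, where $\mathcal{X}'\subsetneq\mathcal{X}$ means $X_i'\subseteq X_i$ for all $i$ and $X_i'\ne X_i$ for some $i$. Periodic cycles in $\mathcal{X}$: the pairs $(\mathbf{x},i)$ with $\mathbf{x}\in\underline{X_i}$ are the vertices of a directed graph having an edge $(\mathbf{x},j)\to(A\mathbf{x}+\mathbf{d},i)$ for each $\mathbf{d}\in\mathcal{D}_{ij}$; a periodic cycle is a directed cycle (possibly a loop) with distinct vertices in this graph, considered up to cyclic rotation. The seed given by the cycle $Y$ is $\mathcal{S}^{(0)}=(S_1,\dots,S_n)$ with $S_i=\{\mathbf{x}_j: i_j=i\}$, all points having multiplicity one. It satisfies $\mathcal{S}^{(0)}\subseteq\psi(\mathcal{S}^{(0)})$, and the limit $\lim_N\psi^N(\mathcal{S}^{(0)})$ is the multiset family whose multiplicity functions are the pointwise limits of the (nondecreasing in $N$) multiplicity functions of the components of $\psi^N(\mathcal{S}^{(0)})$. *)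

(* Defs.v *)
From HB Require Import structures.
From mathcomp Require Import all_boot all_order all_algebra finmap.
From mathcomp Require Import all_classical all_reals topology normedtype.
From mathcomp Require Import complex.

Set Implicit Arguments.
Unset Strict Implicit.
Unset Printing Implicit Defensive.

Import Order.TTheory GRing.Theory Num.Theory.
Import numFieldNormedType.Exports.

Local Open Scope classical_set_scope.
Local Open Scope ring_scope.

(* A multiset in T is its multiplicity function, extended by 0 outside the
   underlying set; multiplicities are finite. *)
Definition multiset (T : Type) := T -> nat.

Definition underlying (T : Type) (X : multiset T) : set T :=
  [set x | (0 < X x)%N].

Definition munion (T : Type) (X Y : multiset T) : multiset T :=
  fun x => (X x + Y x)%N.

Definition mincl (T : Type) (X Y : multiset T) : Prop :=
  forall x, (X x <= Y x)%N.

Definition expanding (R : realType) (d : nat) (A : 'M[R]_d) : Prop :=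
  forall z : R[i], eigenvalue (map_mx (real_complex R) A) z -> 1 < `|z|.

(* Only meaningful for invertible A. *)
Definition mimage (R : realType) (d : nat) (A : 'M[R]_d)
    (X : multiset 'cV[R]_d) : multiset 'cV[R]_d :=
  fun x => X (invmx A *m x).

Definition mtranslate (R : realType) (d : nat) (X : multiset 'cV[R]_d)
    (t : 'cV[R]_d) : multiset 'cV[R]_d :=
  fun x => X (x - t).

Definition msum (R : realType) (d : nat) (X : multiset 'cV[R]_d)
    (D : {fset 'cV[R]_d}) : multiset 'cV[R]_d :=
  fun x => (\sum_(t <- D) mtranslate X t x)%N.

Definition mfamily (R : realType) (d n : nat) := 'I_n -> multiset 'cV[R]_d.

Section Families.
Variables (R : realType) (d n : nat).
Implicit Types X Y : mfamily R d n.

Definition funion X Y : mfamily R d n := fun i => munion (X i) (Y i).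

Definition fincl X Y : Prop := forall i, mincl (X i) (Y i).

Definition fproper X Y : Prop := fincl X Y /\ exists i, X i <> Y i.

Definition fnonempty X : Prop := exists i, underlying (X i) !=set0.

Definition discrete_family X : Prop :=
  forall i (B : set 'cV[R]_d), bounded_set B ->
    finite_set (B `&` underlying (X i)).

Variables (A : 'M[R]_d) (D : 'I_n -> 'I_n -> {fset 'cV[R]_d}).

Definition inflation X : mfamily R d n :=
  fun i x => (\sum_(j < n) msum (mimage A (X j)) (D i j) x)%N.

Definition indecomposable X : Prop :=
  [/\ fnonempty X, inflation X = X &
    ~ exists X1 X2 : mfamily R d n,
        [/\ X = funion X1 X2, fnonempty X1, fnonempty X2,
            inflation X1 = X1 & inflation X2 = X2]].

Definition irreducible_family X : Prop :=
  [/\ fnonempty X, inflation X = X &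
    ~ exists X' : mfamily R d n,
        [/\ fnonempty X', fproper X' X & inflation X' = X']].

Definition edge : rel ('cV[R]_d * 'I_n) :=
  fun u v => has (fun t => v.1 == A *m u.1 + t) (D v.2 u.2).

(* A representative of a cycle, which is only defined up to rotation;
   [cycle edge [:: u]] is a loop at u. *)
Definition periodic_cycle X (Y : seq ('cV[R]_d * 'I_n)) : Prop :=
  [/\ Y != [::], uniq Y, (forall u, u \in Y -> underlying (X u.2) u.1)
    & cycle edge Y].

Definition seed (Y : seq ('cV[R]_d * 'I_n)) : mfamily R d n :=
  fun i x => nat_of_bool ((x, i) \in Y).

(* Pointwise limit of multiplicity functions, for the discrete topology of
   nat. *)
Definition family_limit (F : nat -> mfamily R d n) X : Prop :=
  forall i x, (fun N => F N i x) @ \oo --> X i x.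

End Families.

(* Main.v *)
Require Import Defs.
From mathcomp Require Import all_boot all_order all_algebra finmap.
From mathcomp Require Import all_classical all_reals topology normedtype complex.

(** Encode a multiset family by one weight m on the pairs v = (x, i). Since A is
    invertible, the inflation operator becomes m |-> (v |-> the sum of m over the
    finitely many predecessors of v), an additive operator on weights with values
    in nat [mult_inflation]. This gives the theorem in three steps.

    Subtraction. If m' <= m are both fixed by an additive operator, then so is
    m - m' [transfer_sub]. Hence an indecomposable family dominates no nonempty
    fixed family but itself [indecomposable_minimal], which is irreducibility.

    Existence of a cycle. A point of X has a predecessor in X, so there is an
    infinite backward orbit in X. As A is expanding, backward orbits are bounded
    [expanding_bounded_backward_orbit], so by discreteness the orbit takes finitely
    many values, repeats, and closes up to a cycle Y [discrete_fixed_cycle].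
    The boundedness is obtained without any adapted norm: a product of factors
    A - z over the complex eigenvalues z, counted with multiplicity, kills every
    vector by Cayley-Hamilton, and the factors are removed one at a time, each removal being a scalar
    recursion with ratio 1/z, where |z| > 1 [bounded_seq_factors].

    What the cycle determines. Along a cycle of X multiplicities cannot decrease,
    hence they are constant, and a vertex of the cycle has no predecessor in X
    besides the one on the cycle [cycle_pred_unique]. The iterates of the seed of Y
    increase, stay below X and stay equal to 1 on Y, so their limit is a nonempty
    fixed family below X, that is, X itself: X is generated by Y and has
    multiplicity 1 on it. A cycle that shares a vertex with Y is a rotation of Y,
    because predecessors are unique; on a cycle disjoint from Y all iterates of the
    seed vanish, so X would vanish there too. *)

Set Implicit Arguments.
Unset Strict Implicit.
Unset Printing Implicit Defensive.

(** * Weights fixed by summation over predecessors *)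

Section Transfer.
Variables (T : eqType) (P : T -> seq T).
Implicit Types (m s : T -> nat) (u v : T) (Y : seq T).

Definition transfer m v := \sum_(u <- P v) m u.
Definition pred_edge : rel T := fun u v => u \in P v.

Lemma transfer_sub m m' : (forall v, m' v <= m v) ->
  transfer m =1 m -> transfer m' =1 m' ->
  transfer (fun v => m v - m' v) =1 (fun v => m v - m' v).
Proof.
move=> le_m'm fm fm' v; rewrite /transfer sumnB//.
by rewrite -[in RHS]fm -[in RHS]fm'.
Qed.

Lemma leq_transfer m m' : (forall v, m v <= m' v) ->
  forall v, transfer m v <= transfer m' v.
Proof. by move=> le_mm' v; apply: leq_sum. Qed.

Lemma transfer_fixed_pred m v : transfer m =1 m -> 0 < m v ->
  exists2 u, u \in P v & 0 < m u.
Proof.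
move=> fm; rewrite -fm lt0n sum_nat_seq_neq0 => /hasP[u uP /= mu].
by exists u; rewrite // lt0n.
Qed.

Lemma transfer_fixed_ge m u v : transfer m =1 m -> u \in P v -> m u <= m v.
Proof.
by move=> fm uP; rewrite -[leqRHS]fm /transfer (big_rem u)//= leq_addr.
Qed.

Lemma transfer_fixed_gt m u u' v : transfer m =1 m -> u \in P v ->
  u' \in P v -> u' != u -> 0 < m u' -> m u < m v.
Proof.
move=> fm uP u'P neq mu'; rewrite -[ltnRHS]fm /transfer (big_rem u)//=.
have u'R : u' \in rem u (P v).
  move: (u'P); rewrite (perm_mem (perm_to_rem uP)) inE.
  by rewrite (negbTE neq).
by rewrite (big_rem u')//= -[X in X < _]addn0 ltn_add2l addn_gt0 mu'.
Qed.

(** On a duplicate-free cycle, prev is a permutation, with inverse next. *)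
Lemma perm_map_prev Y : uniq Y -> perm_eq [seq prev Y v | v <- Y] Y.
Proof.
move=> uY; have uP : uniq [seq prev Y v | v <- Y].
  by rewrite map_inj_uniq//; apply: can_inj (next_prev uY).
apply: uniq_perm => //.
have sub : {subset [seq prev Y v | v <- Y] <= Y}.
  by move=> _ /mapP[v vY ->]; rewrite mem_prev.
by have [] := uniq_min_size uP sub; rewrite ?size_map.
Qed.

(** Multiplicities do not decrease along an edge, and they increase strictly at v
    if v has a second positive predecessor. Summed around the cycle this is
    impossible, since both sides add up to the same total. *)
Lemma cycle_pred_unique m Y u v : transfer m =1 m -> uniq Y ->
  cycle pred_edge Y -> v \in Y -> u \in P v -> 0 < m u -> u = prev Y v.
Proof.
move=> fm uY cY vY uP mu; apply/eqP/negPn/negP => neq.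
have le w : w \in Y -> m (prev Y w) <= m w.
  by move=> wY; apply: transfer_fixed_ge fm (prev_cycle cY wY).
suff : \sum_(w <- Y) m (prev Y w) < \sum_(w <- Y) m w.
  by rewrite -(big_map (prev Y) xpredT m) (perm_big _ (perm_map_prev uY)) ltnn.
rewrite !(big_rem v vY)/= -addSn leq_add//.
  exact: transfer_fixed_gt fm (prev_cycle cY vY) uP neq mu.
by rewrite big_seq [leqRHS]big_seq; apply: leq_sum => w /mem_rem; apply: le.
Qed.

(** Both cycles list the iterates of f from u; if one were longer, it would go
    through u again after the length of the other. *)
Lemma fcycle_uniq_cat (f : T -> T) u p q : uniq (u :: p) -> uniq (u :: q) ->
  fcycle f (u :: p) -> fcycle f (u :: q) -> p = q.
Proof.
wlog le_pq : p q / size p <= size q.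
  by move=> wl up uq fp fq; have [/wl|/ltnW/wl] := leqP (size p) (size q);
    [exact | move=> h; apply/esym/h].
move=> _ /= /andP[uNq _]; rewrite !rcons_path => /andP[/fpathE Ep /eqP lp].
move=> /andP[/fpathE Eq _].
suff sz : size p = size q by rewrite Ep Eq sz.
apply/eqP; rewrite eqn_leq le_pq leqNgt; apply/negP => lt_pq.
case/negP: uNq; rewrite Eq; apply/trajectP; exists (size p) => //.
by rewrite -iterSr iterS -[LHS]lp {1}Ep last_traject.
Qed.

Lemma fcycle_uniq_rot (f : T -> T) u Y Y' : uniq Y -> uniq Y' ->
  fcycle f Y -> fcycle f Y' -> u \in Y -> u \in Y' -> exists k, Y' = rot k Y.
Proof.
move=> uY uY' cY cY' /rot_to[i p rp] /rot_to[j q rq].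
have pq : p = q.
  apply: (@fcycle_uniq_cat f u).
  - by rewrite -rp rot_uniq.
  - by rewrite -rq rot_uniq.
  - by rewrite -rp rot_cycle.
  - by rewrite -rq rot_cycle.
have : rot i Y = rot j Y' by rewrite rp rq pq.
by move=> /(congr1 (rotr j)); rewrite rotK => <-; rewrite /rotr rot_rot_add; eexists.
Qed.

(** A choice of predecessor in the support of m, used both to run orbits backward
    and, on a cycle, where the choice is forced, to compare cycles. The default v
    is never returned when m is fixed and positive at v. *)
Definition positive_pred m v := head v [seq u <- P v | 0 < m u].

Lemma positive_predP m v : transfer m =1 m -> 0 < m v ->
  positive_pred m v \in P v /\ 0 < m (positive_pred m v).
Proof.
move=> fm /(transfer_fixed_pred fm)[u uP mu]; rewrite /positive_pred.
have : u \in [seq u <- P v | 0 < m u] by rewrite mem_filter mu.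
case E: [seq _ <- _ | _] => [//|w s] _ /=.
have : w \in [seq u <- P v | 0 < m u] by rewrite E mem_head.
by rewrite mem_filter => /andP[].
Qed.

Definition positive_cycle m Y :=
  [/\ Y != [::], uniq Y, forall v, v \in Y -> 0 < m v & cycle pred_edge Y].

Lemma positive_cycle_pred m Y u v : transfer m =1 m -> positive_cycle m Y ->
  v \in Y -> u \in P v -> 0 < m u -> u \in Y.
Proof.
move=> fm [_ uY mY cY] vY uP mu.
by rewrite (cycle_pred_unique fm uY cY vY uP mu) mem_prev.
Qed.

(** Reversal appears because [positive_pred] goes against the edges. *)
Lemma positive_cycle_fcycle m Y : transfer m =1 m -> positive_cycle m Y ->
  fcycle (positive_pred m) (rev Y).
Proof.
move=> fm [_ uY mY cY]; rewrite rev_cycle.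
apply: (sub_in_cycle (P := [in Y])) (cycle_prev uY).
- move=> u v _ vY /= /eqP ->.
  have [gP mg] := positive_predP fm (mY v vY).
  by rewrite [eqbLHS](cycle_pred_unique fm uY cY vY gP mg).
- exact/allP.
Qed.

Lemma positive_cycle_rot m u Y Y' : transfer m =1 m -> positive_cycle m Y ->
  positive_cycle m Y' -> u \in Y -> u \in Y' -> exists k, Y' = rot k Y.
Proof.
move=> fm cY cY' uY uY'.
have [||||||k] := @fcycle_uniq_rot (positive_pred m) u (rev Y) (rev Y').
- by case: cY => _; rewrite rev_uniq.
- by case: cY' => _; rewrite rev_uniq.
- exact: positive_cycle_fcycle.
- exact: positive_cycle_fcycle.
- by rewrite mem_rev.
- by rewrite mem_rev.
by move=> /(congr1 rev); rewrite revK rev_rot revK => ->; eexists.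
Qed.

(** The shortest return to the repeated vertex w has distinct vertices. *)
Lemma positive_cycle_of_repeat m v a b : transfer m =1 m -> 0 < m v ->
  a < b -> iter a (positive_pred m) v = iter b (positive_pred m) v ->
  exists Y, positive_cycle m Y.
Proof.
set g := positive_pred m; move=> fm mv lt_ab Eab.
have mg k : 0 < m (iter k g v).
  by elim: k => //= k /(positive_predP fm)[].
pose w := iter a g v.
have Ew : exists k, iter k.+1 g w == w.
  exists (b - a).-1; rewrite prednK ?subn_gt0// -iterD subnK 1?ltnW//.
  by rewrite /w Eab.
case: (ex_minnP Ew) => k /eqP ek mink.
exists (rev (traject g w k.+1)); split.
- by rewrite -size_eq0 size_rev size_traject.
- rewrite rev_uniq looping_uniq; apply/negP => /trajectP[i lt_ik E].
  (* One more step turns a repetition inside the period into an earlier return. *)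
  have /mink : iter i.+1 g w == w by apply/eqP; rewrite -[RHS]ek !iterS E.
  by rewrite leqNgt lt_ik.
- by move=> u; rewrite mem_rev => /trajectP[i _ ->]; rewrite /w -iterD.
rewrite rev_cycle; apply: (sub_in_cycle (P := [pred u | 0 < m u]) (e := frel g)).
- by move=> x y mx _ /eqP<-; have [] := positive_predP fm mx.
- by apply/allP => u /trajectP[i _ ->]; rewrite /w -iterD inE.
by rewrite /= rcons_path fpath_traject last_traject; apply/eqP/ek.
Qed.

Lemma nondecreasing_bounded_stationary (f : nat -> nat) M :
  {homo f : a b / a <= b} -> (forall N, f N <= M) ->
  exists N0, forall N, N0 <= N -> f N = f N0.
Proof.
move=> incf lefM.
have exf : exists k, `[< exists N, f N = k >] by exists (f 0); apply/asboolP; exists 0.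
have bdf k : `[< exists N, f N = k >] -> k <= M by move=> /asboolP[N <-].
have [k /asboolP[N0 fN0] maxk] := ex_maxnP exf bdf.
exists N0 => N leN0N; apply/eqP; rewrite eqn_leq (incf _ _ leN0N) andbT fN0.
by apply: maxk; apply/asboolP; exists N.
Qed.

Definition cycle_seed Y v := nat_of_bool (v \in Y).

(** Each vertex of the cycle has a predecessor on the cycle, so the seed lies below
    its image, and the operator is monotone. *)
Lemma iter_seed_homo Y v : cycle pred_edge Y ->
  {homo (fun N => iter N transfer (cycle_seed Y) v) : a b / a <= b}.
Proof.
move=> cY; apply: homo_leq => [//||N]; first exact: leq_trans.
elim: N v => [|N IHN] v; last exact: leq_transfer.
rewrite iterS [leqLHS]/=; case: (boolP (v \in Y)) => [vY|vNY]; last first.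
  by rewrite /cycle_seed (negbTE vNY).
rewrite /cycle_seed vY /transfer (big_rem (prev Y v))/=.
  by rewrite mem_prev vY.
exact: prev_cycle cY vY.
Qed.

Lemma iter_seed_le m Y N v : transfer m =1 m -> positive_cycle m Y ->
  iter N transfer (cycle_seed Y) v <= m v.
Proof.
move=> fm [_ _ mY _]; elim: N v => [|N IHN] v /=.
  by rewrite /cycle_seed; case: (boolP (v \in Y)) => // /mY.
by rewrite -[leqRHS]fm; apply: leq_transfer.
Qed.

(** The predecessors off the cycle carry no weight of m, hence none of the
    iterates, which lie below m. *)
Lemma iter_seed_cycle m Y N v : (forall v, uniq (P v)) -> transfer m =1 m ->
  positive_cycle m Y -> v \in Y -> iter N transfer (cycle_seed Y) v = 1.
Proof.
move=> uP fm cY; elim: N v => [|N IHN] v vY /=; first by rewrite /cycle_seed vY.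
have [_ uY mY eY] := cY.
rewrite /transfer (bigD1_seq (prev Y v)) ?uP//=; last exact: prev_cycle eY vY.
rewrite IHN ?mem_prev// big1_seq// => u /andP[neq uPv].
apply/eqP; rewrite -leqn0; apply: leq_trans (iter_seed_le N u fm cY) _.
rewrite leqNgt; apply: contra neq => mu.
exact/eqP/(cycle_pred_unique fm uY eY vY uPv mu).
Qed.

(** All the positive predecessors of a vertex of Y' lie on Y', so no weight ever
    flows into Y' from outside. *)
Lemma iter_seed_disjoint m Y Y' N v : transfer m =1 m -> positive_cycle m Y ->
  positive_cycle m Y' -> (forall u, u \in Y' -> u \notin Y) -> v \in Y' ->
  iter N transfer (cycle_seed Y) v = 0.
Proof.
move=> fm cY cY' disj; elim: N v => [|N IHN] v vY' /=.
  by rewrite /cycle_seed (negbTE (disj _ vY')).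
rewrite /transfer big1_seq// => u /andP[_ uPv].
have [mu0|mu] := posnP (m u); last exact/IHN/(positive_cycle_pred fm cY' vY').
by apply/eqP; rewrite -leqn0 -{2}mu0; exact: iter_seed_le fm cY.
Qed.

(** The limit is fixed because each value depends on finitely many others, all of
    which are stationary from some common rank on. *)
Lemma iter_seed_limit m Y : transfer m =1 m -> positive_cycle m Y ->
  exists2 z, transfer z =1 z &
    forall v, exists N0, forall N, N0 <= N ->
      iter N transfer (cycle_seed Y) v = z v.
Proof.
move=> fm cY; have [_ _ _ eY] := cY.
have stat v := nondecreasing_bounded_stationary (@iter_seed_homo Y v eY)
  (fun N => iter_seed_le N v fm cY).
pose N0 v := projT1 (cid (stat v)).
pose z v := iter (N0 v) transfer (cycle_seed Y) v.
have zE v N : N0 v <= N -> iter N transfer (cycle_seed Y) v = z v.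
  exact: projT2 (cid (stat v)) N.
exists z => [v|v]; last by exists (N0 v) => N; apply: zE.
pose N1 := maxn (N0 v) (\max_(u <- P v) N0 u).
rewrite -(zE v N1.+1) ?leqW ?leq_maxl//= /transfer; apply: eq_big_seq => u uP.
rewrite zE//; apply: leq_trans (leq_maxr _ _).
exact: leq_bigmax_seq.
Qed.

(** ** The cycle of a minimal fixed weight *)

Section Irreducible.
Variable m : T -> nat.
Hypotheses (uniqP : forall v, uniq (P v)) (fm : transfer m =1 m).
Hypothesis irr : forall m', transfer m' =1 m' -> (forall v, m' v <= m v) ->
  (exists v, 0 < m' v) -> m' =1 m.

(** The limit of the iterates is fixed, lies below m, and is not zero since it is 1
    on Y; minimality leaves only m. *)
Lemma irreducible_generated Y v : positive_cycle m Y ->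
  exists N0, forall N, N0 <= N -> iter N transfer (cycle_seed Y) v = m v.
Proof.
move=> cY; have [z fz zE] := iter_seed_limit fm cY.
suff <- : z =1 m by apply: zE.
apply: irr => // [u|].
  by have [N zN] := zE u; rewrite -(zN N)//; apply: iter_seed_le fm cY.
have [Y0 _ mY _] := cY; case: (Y) Y0 cY zE => // u p _ cY zE.
exists u; have [N zN] := zE u.
by rewrite -(zN N)// (iter_seed_cycle N uniqP fm cY) ?mem_head.
Qed.

Lemma irreducible_mult1 Y v : positive_cycle m Y -> v \in Y -> m v = 1.
Proof.
move=> cY vY; have [N EN] := irreducible_generated v cY.
by rewrite -(EN N)//; apply: iter_seed_cycle cY vY.
Qed.

Lemma irreducible_cycle_unique Y Y' : positive_cycle m Y ->
  positive_cycle m Y' -> exists k, Y' = rot k Y.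
Proof.
move=> cY cY'; suff /hasP[u uY' uY] : has [in Y] Y'.
  exact: positive_cycle_rot fm cY cY' uY uY'.
apply/negPn/negP => /hasPn disj.
have [Y'0 _ mY' _] := cY'; case E: Y' Y'0 => [//|u p] _.
have uY' : u \in Y' by rewrite E mem_head.
have [N E0] := irreducible_generated u cY.
have := mY' u uY'; rewrite -(E0 N)//.
by rewrite (iter_seed_disjoint N fm cY cY').
Qed.

End Irreducible.

End Transfer.

Import Order.TTheory GRing.Theory Num.Theory.
Import numFieldNormedType.Exports.

(** * Backward orbits of expanding maps are bounded *)

Section BoundedOrbits.
Local Open Scope ring_scope.
Variables (K : numFieldType) (d : nat).
Implicit Types (y t : nat -> 'cV[K]_d) (B : 'M[K]_d).

(** The condition 0 <= M does not follow from the bounds on the entries when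
    d = 0. *)
Definition bounded_seq y :=
  exists2 M, 0 <= M & forall k i, `|y k i 0| <= M.

Lemma bounded_seqD y t : bounded_seq y -> bounded_seq t ->
  bounded_seq (fun k => y k + t k).
Proof.
move=> [M M0 yM] [M' M'0 tM']; exists (M + M'); first exact: addr_ge0.
by move=> k i; rewrite mxE (le_trans (ler_normD _ _))// lerD.
Qed.

(** The bound adds all the entries of B, so that it serves every row at once. *)
Lemma bounded_seq_mulmx B y : bounded_seq y ->
  bounded_seq (fun k => B *m y k).
Proof.
move=> [M M0 yM]; exists (\sum_i \sum_j `|B i j| * M).
  by apply: sumr_ge0 => i _; apply: sumr_ge0 => j _; apply: mulr_ge0.
move=> k i; rewrite mxE (le_trans (ler_norm_sum _ _ _))//.
rewrite [leRHS](bigD1 i)//=; apply: ler_wpDr.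
  by apply: sumr_ge0 => l _; apply: sumr_ge0 => j _; apply: mulr_ge0.
by apply: ler_sum => j _; rewrite normrM ler_wpM2l.
Qed.

(** The scalar case of the expansion argument, applied to each coordinate. *)
Lemma bounded_seq_affine z y t : 1 < `|z| -> bounded_seq t ->
  (forall k, z *: y k.+1 = y k + t k) -> bounded_seq y.
Proof.
move=> z1 [M M0 tM] rec; have z0 : 0 < `|z| - 1 by rewrite subr_gt0.
pose K0 := \sum_i `|y 0%N i 0|.
have K00 : 0 <= K0 by apply: sumr_ge0.
have Mz0 : 0 <= M / (`|z| - 1) by rewrite divr_ge0// ltW.
(* A constant L with (L + M) / |z| <= L is preserved by the recursion; this
   means M <= L (|z| - 1). The summand K0 takes care of the initial value. *)
exists (K0 + M / (`|z| - 1)); first exact: addr_ge0.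
elim=> [|k IHk] i.
  by apply: ler_wpDr => //; rewrite /K0 (bigD1 i)//= lerDl sumr_ge0.
have zgt0 : 0 < `|z| by apply: lt_trans z1.
rewrite -(ler_pM2l zgt0) -normrM.
have -> : z * y k.+1 i 0 = y k i 0 + t k i 0.
  by have /matrixP/(_ i 0) := rec k; rewrite !mxE.
rewrite (le_trans (ler_normD _ _))//.
rewrite (le_trans (lerD (IHk i) (tM k i)))//.
rewrite -lerBrDl -[X in _ - X]mul1r -mulrBl mulrDr mulrCA divff ?gt_eqF// mulr1.
by rewrite lerDr mulr_ge0// ltW.
Qed.

End BoundedOrbits.

Section Expanding.
Local Open Scope ring_scope.

(** Let Q be the product of the remaining factors and w = Q y. As Q commutes with B,
    B w_(k+1) = w_k + Q t_k, that is,
    z w_(k+1) = w_k + Q t_k - (B - z) w_(k+1).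
    If (B - z) w is bounded, this is a scalar expanding recursion with bounded
    perturbation, so w is bounded: the factor B - z has been removed. *)
Lemma bounded_seq_factors (K : numFieldType) (d : nat) (B : 'M[K]_d.+1)
    (zs : seq K) (y t : nat -> 'cV[K]_d.+1) :
  (forall z, z \in zs -> 1 < `|z|) -> bounded_seq t ->
  (forall k, B *m y k.+1 = y k + t k) ->
  bounded_seq (fun k => horner_mx B (\prod_(z <- zs) ('X - z%:P)) *m y k) ->
  bounded_seq y.
Proof.
move=> + bt rec; elim: zs => [|z zs IHzs] z1.
  rewrite big_nil rmorph1 => -[M M0 yM]; exists M => // k i.
  by rewrite -[y k]mul1mx.
rewrite big_cons rmorphM rmorphB/= horner_mx_X horner_mx_C.
set Q := horner_mx B _ => bw; apply: IHzs => [u uzs|].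
  by apply: z1; rewrite inE uzs orbT.
rewrite -/Q.
have QB : Q *m B = B *m Q.
  by apply/eqP; rewrite !mulmxE -[B]horner_mx_X -!rmorphM mulrC.
apply: (@bounded_seq_affine _ _ z _
  (fun k => Q *m t k + (- 1%:M) *m ((B - z%:M) * Q *m y k.+1))).
- by apply: z1; rewrite mem_head.
- apply: bounded_seqD; apply: bounded_seq_mulmx => //.
  by have [M M0 wM] := bw; exists M => // k i; apply: wM.
move=> k; rewrite mulNmx mul1mx addrA -mulmxDr -rec mulmxA QB.
have -> : (B - z%:M) * Q = B *m Q - z *: Q.
  by rewrite mulrBl -!mulmxE mul_scalar_mx.
by rewrite mulmxBl scalemxAl opprB addrC subrK.
Qed.

(** By Cayley-Hamilton the characteristic polynomial, split into linear factors,
    sends the orbit to the zero sequence, from which the factors can be removed. *)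
Lemma bounded_backward_orbit (C : numClosedFieldType) (d : nat)
    (B : 'M[C]_d.+1) (y t : nat -> 'cV[C]_d.+1) :
  (forall z, eigenvalue B z -> 1 < `|z|) -> bounded_seq t ->
  (forall k, B *m y k.+1 = y k + t k) -> bounded_seq y.
Proof.
move=> expB bt rec; have [zs] := closed_field_poly_normal (char_poly B).
rewrite (monicP (char_poly_monic B)) scale1r => Ezs.
apply: (bounded_seq_factors (zs := zs) _ bt rec).
  by move=> z zzs; apply: expB; rewrite eigenvalue_root_char Ezs root_prod_XsubC.
rewrite -Ezs Cayley_Hamilton; exists 0 => // k i.
by rewrite mul0mx mxE normr0.
Qed.

Variable R : realType.

Lemma expanding_unitmx d (A : 'M[R]_d) : expanding A -> A \in unitmx.
Proof.
move=> expA; rewrite unitmxE unitfE; apply/negP => detA0.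
have : eigenvalue (map_mx (real_complex R) A) 0.
  have /det0P[v v0 vA] : \det (map_mx (real_complex R) A) == 0.
    by rewrite det_map_mx (eqP detA0) rmorph0.
  by apply/eigenvalueP; exists v; rewrite // scale0r.
by move/expA; rewrite normr0 ltr10.
Qed.

Lemma expanding_bounded_backward_orbit d (A : 'M[R]_d) (y t : nat -> 'cV[R]_d) :
  (0 < d)%N -> expanding A -> bounded_seq t ->
  (forall k, A *m y k.+1 = y k + t k) -> bounded_seq y.
Proof.
case: d A y t => // d A y t _ expA [M M0 tM] rec.
pose c := map_mx (real_complex R).
have normc (x : R) : `|real_complex R x| = real_complex R `|x|.
  by rewrite normc_def/= expr0n/= addr0 sqrtr_sqr.
have [] := @bounded_backward_orbit _ d (c _ _ A) (c _ _ \o y) (c _ _ \o t) expA.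
- exists (real_complex R M); first by rewrite ler0c.
  by move=> k i; rewrite mxE normc lecR.
- by move=> k; rewrite /c -map_mxM rec map_mxD.
move=> N N0 yN; exists (complex.Re N).
  by move: N0; rewrite lecE => /andP[].
by move=> k i; have := yN k i; rewrite mxE normc lecE => /andP[].
Qed.

End Expanding.

(** * The inflation graph *)

Section InflationGraph.
Local Open Scope classical_set_scope.
Local Open Scope ring_scope.
Variables (R : realType) (d n : nat) (A : 'M[R]_d).
Variable D : 'I_n -> 'I_n -> {fset 'cV[R]_d}.
Local Notation vertex := ('cV[R]_d * 'I_n)%type.
Implicit Types (X : mfamily R d n) (m : vertex -> nat) (u v : vertex).

(** The vertices with an edge to v: x = A y + t has the only solution
    y = A^-1 (x - t). *)
Definition preimages v : seq vertex :=
  [seq (invmx A *m (v.1 - t), j) | j <- enum 'I_n, t <- enum_fset (D v.2 j)].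

Definition mult X v := X v.2 v.1.
Definition family_of m : mfamily R d n := fun i x => m (x, i).

Lemma family_ofK m : mult (family_of m) = m.
Proof. by apply/funext => -[]. Qed.

Lemma mult_seed (Y : seq vertex) : mult (seed Y) = cycle_seed Y.
Proof. by apply/funext => -[]. Qed.

Lemma mult_inflation X : mult (inflation A D X) =1 transfer preimages (mult X).
Proof.
move=> [x i]; rewrite /transfer /preimages big_allpairs_dep big_enum /=.
by rewrite /mult /inflation.
Qed.

Lemma mult_inj X Y : mult X =1 mult Y -> X = Y.
Proof. by move=> eXY; apply/funext => i; apply/funext => x; apply: (eXY (x, i)). Qed.

Lemma inflation_fixed X : inflation A D X = X <->
  transfer preimages (mult X) =1 mult X.
Proof.
split=> [fX v|fX]; first by rewrite -mult_inflation fX.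
by apply: mult_inj => v; rewrite mult_inflation fX.
Qed.

Lemma mult_iter_inflation N X : mult (iter N (inflation A D) X) =1
  iter N (transfer preimages) (mult X).
Proof.
elim: N => //= N IHN v; rewrite mult_inflation.
by apply: eq_bigr => u _; rewrite IHN.
Qed.

Lemma fnonemptyP X : fnonempty X <-> exists v, (0 < mult X v)%N.
Proof.
split=> [[i [x Xx]]|[[x i] Xx]]; first by exists (x, i).
by exists i; exists x.
Qed.

Hypothesis unitA : A \in unitmx.

(** Distinct digits yield distinct predecessors, so the graph has no multiple edge
    and the multiplicities on a cycle can be counted through single edges. *)
Lemma preimages_uniq v : uniq (preimages v).
Proof.
apply: allpairs_uniq_dep; rewrite ?enum_uniq//.
  by move=> j _; apply: fset_uniq.
move=> [j t] [j' t'] _ _ /= [+ ejj']; rewrite {}ejj'.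
by move=> /(can_inj (mulKVmx unitA))/addrI/oppr_inj->.
Qed.

Lemma edgeE : edge A D =2 pred_edge preimages.
Proof.
move=> u v; apply/hasP/allpairsPdep => /= [[t tD /eqP ev]|].
  exists u.2, t; rewrite mem_enum; split=> //.
  by rewrite ev addrK mulKmx//; case: u {tD ev}.
move=> [j [t [_ tD ->]]]; exists t => //=.
by rewrite mulKVmx// subrK.
Qed.

Lemma periodic_cycleE X Y :
  periodic_cycle A D X Y <-> positive_cycle preimages (mult X) Y.
Proof. by rewrite /periodic_cycle (eq_cycle edgeE). Qed.

(** A smaller fixed weight m would split X as m plus the difference, which is fixed
    too. *)
Lemma indecomposable_minimal X m : indecomposable A D X ->
  transfer preimages m =1 m -> (forall v, m v <= mult X v)%N ->
  (exists v, 0 < m v)%N -> m =1 mult X.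
Proof.
move=> [_ /inflation_fixed fX indX] fm le_mX [v mv] w.
apply/eqP; rewrite eqn_leq le_mX leqNgt; apply/negP => lt_mX; apply: indX.
exists (family_of m), (family_of (fun u => mult X u - m u)%N); split.
- apply: mult_inj => u; rewrite -[RHS]/(mult (family_of _) u + mult (family_of _) u)%N.
  by rewrite !family_ofK subnKC.
- by apply/fnonemptyP; exists v; rewrite family_ofK.
- by apply/fnonemptyP; exists w; rewrite family_ofK subn_gt0.
- by apply/inflation_fixed; rewrite family_ofK.
- by apply/inflation_fixed; rewrite family_ofK; apply: transfer_sub.
Qed.

(** Going backward, A y_(k+1) = y_k - t_k, where t_k is one of finitely many
    digits. *)
Lemma backward_orbit_bounded (p : nat -> vertex) : (0 < d)%N -> expanding A ->
  (forall k, p k.+1 \in preimages (p k)) -> bounded_seq (fun k => (p k).1).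
Proof.
move=> d0 expA pred.
apply: (expanding_bounded_backward_orbit (t := fun k => A *m (p k.+1).1 - (p k).1) d0 expA).
  (* The sum of all digit entries bounds every single one of them. *)
  pose M : R := \sum_(i < n) \sum_(j < n) \sum_(t <- D i j) \sum_l `|t l 0|.
  have M_ge0 : 0 <= M by do ![apply: sumr_ge0 => ? _].
  exists M => // k l; have /allpairsPdep[j [t [_ tD ->]]] := pred k.
  rewrite mulKVmx//= addrAC subrr sub0r mxE normrN.
  rewrite /M (bigD1 (p k).2)//=; apply: ler_wpDr.
    by do ![apply: sumr_ge0 => ? _].
  rewrite (bigD1 j)//=; apply: ler_wpDr.
    by do ![apply: sumr_ge0 => ? _].
  rewrite (big_rem t)//=; apply: ler_wpDr.
    by do ![apply: sumr_ge0 => ? _].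
  by rewrite (bigD1 l)//= lerDl; apply: sumr_ge0.
by move=> k; rewrite addrC subrK.
Qed.

Lemma discrete_bounded_repeat X (p : nat -> vertex) : discrete_family X ->
  (forall k, 0 < mult X (p k))%N -> bounded_seq (fun k => (p k).1) ->
  exists a b, (a < b)%N /\ p a = p b.
Proof.
move=> discX pX [M M0 pM]; pose B := [set x : 'cV[R]_d | forall i, `|x i 0| <= M].
have bB : bounded_set B.
  apply: filterS (nbhs_pinfty_ge (num_real M)) => N leMN x Bx /=.
  rewrite [leLHS]/Num.norm/= mx_normrE; apply/bigmax_leP; split=> [|[i j] _ /=].
    exact: le_trans leMN.
  by rewrite (ord1 j) (le_trans (Bx i)).
pose V := \bigcup_(i in [set: 'I_n]) ((fun x => (x, i)) @` (B `&` underlying (X i))).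
have finV : finite_set V.
  apply: bigcup_finite => [|i _]; first exact: finite_finset.
  exact/finite_image/discX.
apply: contrapT => norep; apply: infinite_nat.
have -> : [set: nat] = p @^-1` V.
  apply/seteqP; split=> // k _; exists (p k).2 => //; exists (p k).1.
    by split=> [i|]; [apply: pM | apply: pX].
  by rewrite -surjective_pairing.
apply: finite_preimage finV => a b _ _ pab; apply: contrapT => /eqP.
rewrite neq_ltn => /orP[] lt; case: norep; first by exists a, b.
by exists b, a.
Qed.

Lemma discrete_fixed_cycle X : (0 < d)%N -> expanding A ->
  discrete_family X -> inflation A D X = X -> fnonempty X ->
  exists Y, positive_cycle preimages (mult X) Y.
Proof.
move=> d0 expA discX /inflation_fixed fX /fnonemptyP[v Xv].
pose p k := iter k (positive_pred preimages (mult X)) v.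
have Xp k : (0 < mult X (p k))%N.
  by elim: k => // k /(positive_predP fX)[].
have predp k : p k.+1 \in preimages (p k) by have [] := positive_predP fX (Xp k).
have bp := backward_orbit_bounded d0 expA predp.
have [a [b [lt_ab Eab]]] := discrete_bounded_repeat discX Xp bp.
exact: positive_cycle_of_repeat fX Xv lt_ab Eab.
Qed.

End InflationGraph.

(** * The structure theorem *)

Theorem theorem2p2 (R : realType) (d n : nat) (hd : (0 < d)%N) (hn : (0 < n)%N)
    (A : 'M[R]_d) (hA : expanding A) (D : 'I_n -> 'I_n -> {fset 'cV[R]_d})
    (X : mfamily R d n) (hX : inflation A D X = X)
    (hdisc : discrete_family X) (hind : indecomposable A D X) :
  irreducible_family A D X /\
  exists Y : seq ('cV[R]_d * 'I_n),
    [/\ periodic_cycle A D X Y,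
        family_limit (fun N => iter N (inflation A D) (seed Y)) X,
        (forall Y', periodic_cycle A D X Y' -> exists k, Y' = rot k Y)
      & forall u, u \in Y -> X u.2 u.1 = 1%N].
Proof.
have unitA := expanding_unitmx hA; have [X0 _ _] := hind.
have fX := (inflation_fixed A D X).1 hX.
have minX m := @indecomposable_minimal _ _ _ A D X m hind.
split.
  split=> // -[X' [/fnonemptyP X'0 [leX' [i neq]] /inflation_fixed fX']].
  apply: neq; have := minX _ fX' (fun v => leX' v.2 v.1) X'0.
  by move=> /mult_inj->.
have [Y cY] := discrete_fixed_cycle unitA hd hA hdisc hX X0.
have uP := preimages_uniq D unitA.
exists Y; split.
- exact/periodic_cycleE.
- move=> i x; apply: cvg_near_cst.
  have [N0 E0] := irreducible_generated uP fX minX (x, i) cY.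
  exists N0 => // N /= /E0 E.
  by rewrite -[LHS]/(mult _ (x, i)) mult_iter_inflation mult_seed E.
- move=> Y' /(periodic_cycleE _ unitA) cY'.
  exact: (irreducible_cycle_unique uP fX minX cY cY').
- by move=> u uY; apply: (irreducible_mult1 uP fX minX cY uY).
Qed.
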